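(* Let $n\ge 1$, let $x_0,\dots,x_n$ be variables, and let $y_i=x_0+x_1+\dots+x_i$ for $0\le i\le n$. For any homogeneous polynomial $h(t_0,\dots,t_n)$ of degree $n$, $$\Phi\bigl(h(y_0,y_1,\dots,y_n)+h(y_1,y_2,\dots,y_n,y_0)+\dots+h(y_n,y_0,\dots,y_{n-1})\bigr)=n!\,h(1,1,\dots,1),$$ where the argument of $\Phi$ is the sum of $h$ over all $n+1$ cyclic shifts of $(y_0,\dots,y_n)$.
   Context: For a polynomial $f(x_0,\dots,x_n)$ with coefficients in some field, $$\Phi(f)=\operatorname{Sym}\left(\frac{f}{\prod_{i=0}^{n-1}(x_i-x_{i+1})}\right),$$ where for a rational function $\varphi$ of the variables, $\operatorname{Sym}\varphi=\sum_{\pi}\varphi(\pi_0,\dots,\pi_n)$ is the sum over all $(n+1)!$ permutations $\pi$ of the variables $x_0,\dots,x_n$. $\Phi(f)$ is a polynomial of degree at most $\deg f-n$, so it is a constant when $\deg f\le n$. *)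

(* Defs.v *)
From mathcomp Require Import all_boot all_order perm all_algebra.
From mathcomp Require Import generic_quotient.
From mathcomp.multinomials Require Import mpoly.

Set Implicit Arguments.
Unset Strict Implicit.
Unset Printing Implicit Defensive.

Import GRing.Theory.
Local Open Scope ring_scope.
Local Open Scope quotient_scope.

Notation "x %:F" := (FracField.tofrac x) : ring_scope.

Lemma frac_repr (R : idomainType) (x : {fraction R}) :
  x = (\n_(repr x))%:F / (\d_(repr x))%:F.
Proof.
rewrite -{1}[x]reprK; move: (repr x) => r; unlock FracField.tofrac.
rewrite -[_^-1]FracField.pi_inv -[RHS]FracField.pi_mul.
rewrite /FracField.mulf /FracField.invf.
by rewrite !numden_Ratio ?(oner_neq0, denom_ratioP, mulr1, mul1r, Ratio_numden).
Qed.

Section Sym.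
Variables (F : fieldType) (n : nat).
Implicit Types (s : 'S_n) (p q : {mpoly F[n]}) (phi : {fraction {mpoly F[n]}}).

Lemma msym_var s (i : 'I_n) : msym s ('X_i : {mpoly F[n]}) = 'X_(s i).
Proof.
rewrite msymX; congr ('X_[_]); apply/mnmP => j; rewrite mnmE !mnm1E.
by rewrite -(inj_eq (@perm_inj _ s) i) permKV.
Qed.

(* phi(x_(s 0), ..., x_(s (n - 1))), computed on a chosen representative;
   [perm_fracE] shows that the choice is irrelevant. *)
Definition perm_frac s phi : {fraction {mpoly F[n]}} :=
  (msym s \n_(repr phi))%:F / (msym s \d_(repr phi))%:F.

Lemma perm_fracE s p q :
  q != 0 -> perm_frac s (p%:F / q%:F) = (msym s p)%:F / (msym s q)%:F.
Proof.
move=> q0; rewrite /perm_frac; set phi := p%:F / q%:F.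
have msym_neq0 r : r != 0 -> (msym s r)%:F != 0.
  by rewrite tofrac_eq0 -(inj_eq (@inj_msym _ _ s)) msym0.
have d0 : \d_(repr phi) != 0 by exact: denom_ratioP.
have : phi = (\n_(repr phi))%:F / (\d_(repr phi))%:F by exact: frac_repr.
rewrite {1}/phi => /eqP; rewrite eqr_div ?tofrac_eq0 // -!tofracM tofrac_eq.
move=> /eqP pd; apply/eqP; rewrite eqr_div ?msym_neq0 // -!tofracM tofrac_eq.
by rewrite -!msymM pd.
Qed.

Definition Sym phi : {fraction {mpoly F[n]}} := \sum_(s : 'S_n) perm_frac s phi.

End Sym.

Definition Phi (F : fieldType) (n : nat) (f : {mpoly F[n.+1]}) :
    {fraction {mpoly F[n.+1]}} :=
  Sym (f%:F / (\prod_(i < n) ('X_(widen_ord (leqnSn n) i) - 'X_(lift ord0 i)))%:F).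

Definition ysum (F : fieldType) (n : nat) (i : 'I_n.+1) : {mpoly F[n.+1]} :=
  \sum_(j < n.+1 | (j <= i)%N) 'X_j.

(* h(y_k, y_(k+1), ..., y_n, y_0, ..., y_(k-1)); the sum i + k is taken in
   'I_n.+1, hence modulo n + 1. *)
Definition cyclic_shift (F : fieldType) (n : nat) (h : {mpoly F[n.+1]})
    (k : 'I_n.+1) : {mpoly F[n.+1]} :=
  h \mPo [tuple ysum F (i + k) | i < n.+1].

(* Main.v *)
(** Let V be the Vandermonde product of the x_i and D = prod (x_i - x_(i+1)).
   Then Phi(f) = E(f) / V, where E(f) antisymmetrizes (V / D) f.  Multiplying f
   by some of the factors of D cuts the variables into blocks; if the rest of f
   is block-symmetric up to a factor of too small degree, every monomial to be
   antisymmetrized has equal exponents at two indices of one block, and E(f)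
   vanishes.  With 2 y_c - y_(c-1) - y_(c+1) = x_c - x_(c+1) this gives
     E(y_n G) = 0  and  E(y_c (2 y_c - y_(c+1) - y_(c-1)) G) = 0  (c mod n + 1)
   for G of degree n - 1, respectively n - 2.  Hence the cyclic sum of
   E(y_(phi 0) ... y_(phi (n-1))) is a function of phi which is harmonic under
   moving one of two chips on the same site of the cycle of length n + 1, and
   by the maximum principle it is constant, equal to its value
   E(y_0 ... y_(n-1)) at injective phi.  The latter is computed by trading the
   factors of D for y_0, ..., y_(n-1) one at a time, starting from
   E(D) = (n + 1)! V.  The divisions involved require characteristic 0, so all
   this is done over the integers and then mapped to the field. *)
From HB Require Import structures.
Require Import Defs.
From mathcomp Require Import all_boot all_order all_fingroup all_algebra.
From mathcomp Require Import zify ring.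
From mathcomp.multinomials Require Import mpoly.

Set Implicit Arguments.
Unset Strict Implicit.
Unset Printing Implicit Defensive.

Import Order.TTheory GRing.Theory Num.Theory.
Local Open Scope ring_scope.

(** * Degrees of products and of variables *)

Lemma dhomog_big_prod (R : comNzRingType) N (I : Type) (r : seq I) (P : pred I)
    (f : I -> {mpoly R[N]}) (d : I -> nat) :
    (forall i, P i -> f i \is (d i).-homog) ->
  \prod_(i <- r | P i) f i \is (\sum_(i <- r | P i) d i)%N.-homog.
Proof.
move=> fh; elim/big_rec2: _ => [|i e p Pi ph]; first exact: dhomog1.
by apply: dhomogM => //; apply: fh.
Qed.

Lemma dhomog_var (R : comNzRingType) N (i : 'I_N) :
  ('X_i : {mpoly R[N]}) \is 1.-homog.
Proof. by rewrite dhomogX /= mdeg1. Qed.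

(** * Antisymmetrization and products of differences *)

Section Asym.
Variables (R : comNzRingType) (N : nat).
Implicit Types (s t : 'S_N) (p q : {mpoly R[N]}) (i j : 'I_N).

Definition asym p : {mpoly R[N]} := \sum_(s : 'S_N) (-1) ^+ s * msym s p.

(** Indexing by a relation reduces regroupings of the Vandermonde factors to disjoint unions of
    relations. *)
Definition diff_prod (P : rel 'I_N) : {mpoly R[N]} :=
  \prod_(ij : 'I_N * 'I_N | P ij.1 ij.2) ('X_ij.1 - 'X_ij.2).

Definition vand := diff_prod (fun i j => (i < j)%N).

Lemma msymXU s i : msym s ('X_i : {mpoly R[N]}) = 'X_(s i).
Proof.
rewrite msymX; congr ('X_[_]); apply/mnmP => j; rewrite mnmE !mnm1E.
by rewrite -(inj_eq (@perm_inj _ s) i) permKV.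
Qed.

Lemma asym_is_additive : additive asym.
Proof.
move=> p q; rewrite /asym -sumrB; apply: eq_bigr => s _.
by rewrite raddfB mulrBr.
Qed.

HB.instance Definition _ :=
  GRing.isAdditive.Build {mpoly R[N]} {mpoly R[N]} asym asym_is_additive.

Lemma asymZ c p : asym (c *: p) = c *: asym p.
Proof.
by rewrite /asym scaler_sumr; apply: eq_bigr => s _; rewrite msymZ scalerAr.
Qed.

Lemma asym_msym t p : asym (msym t p) = (-1) ^+ t * asym p.
Proof.
rewrite /asym mulr_sumr (reindex_inj (mulgI t^-1%g)) /=; apply: eq_bigr => s _.
by rewrite -msymMm mulKVg odd_permM odd_permV signr_addb mulrA.
Qed.

(** Negating the nodes makes the determinant's factors [x_i - x_j] for [i < j]. Permuting the
    variables then permutes columns, whence the sign in [msym_vand]. *)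
Lemma vandE :
  vand = \det (Vandermonde N (\row_i (- 'X_i : {mpoly R[N]}))).
Proof.
rewrite det_Vandermonde pair_big_dep /=; apply: eq_bigr => -[i j] /= _.
by rewrite !mxE opprK addrC.
Qed.

Lemma msym_vand s : msym s vand = (-1) ^+ s * vand.
Proof.
rewrite vandE -[LHS]det_map_mx -[(-1) ^+ s]mul1r.
have -> : map_mx (msym s) (Vandermonde N (\row_i (- 'X_i : {mpoly R[N]})))
  = col_perm s (Vandermonde N (\row_i (- 'X_i : {mpoly R[N]}))).
  by apply/matrixP => i j; rewrite !mxE rmorphXn /= msymN msymXU.
by rewrite col_permE det_mulmx det_perm mulrC mul1r odd_permV.
Qed.

Lemma asym_vand : asym vand = vand *+ N`!.
Proof.
rewrite /asym (eq_bigr (fun=> vand)) => [|s _].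
  by rewrite sumr_const card_Sn.
by rewrite msym_vand signrMK.
Qed.

Lemma msym_diff_prod s (P : rel 'I_N) :
    (forall i j, P (s i) (s j) = P i j) ->
  msym s (diff_prod P) = diff_prod P.
Proof.
move=> Ps; rewrite /diff_prod rmorph_prod /=.
rewrite [RHS](reindex (fun ij : 'I_N * 'I_N => (s ij.1, s ij.2))) /=; last first.
  exists (fun ij => (s^-1%g ij.1, s^-1%g ij.2)) => -[i j] _ /=;
    by rewrite ?permK ?permKV.
apply: eq_big => [[i j]|[i j] _] /=; first by rewrite Ps.
by rewrite msymB !msymXU.
Qed.

Lemma diff_prodM (P Q S : rel 'I_N) :
    (forall i j, ~~ (P i j && Q i j)) -> (forall i j, S i j = P i j || Q i j) ->
  diff_prod P * diff_prod Q = diff_prod S.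
Proof.
move=> PQ SE; rewrite /diff_prod [RHS](bigID (fun ij => P ij.1 ij.2)) /=.
congr (_ * _); apply: eq_bigl => -[i j] /=; rewrite SE;
  by have := PQ i j; case: (P i j); case: (Q i j).
Qed.

Lemma dhomog_diff_prod (P : rel 'I_N) :
  diff_prod P \is #|[pred ij : 'I_N * 'I_N | P ij.1 ij.2]|.-homog.
Proof.
rewrite -sum1_card; apply: dhomog_big_prod => ij _.
by rewrite rpredB // dhomog_var.
Qed.

End Asym.

(** * Vanishing of antisymmetrizations for degree reasons *)

Section Vanishing.
Variable N : nat.
Implicit Types (p : {mpoly int[N]}) (col : 'I_N -> nat).

(** The transposition gives [asym p = - asym p], and integer coefficients have no 2-torsion. *)
Lemma asym_tperm_eq0 p i j : i != j -> msym (tperm i j) p = p -> asym p = 0.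
Proof.
move=> ij pij; have := asym_msym (tperm i j) p.
rewrite pij odd_tperm ij expr1 mulN1r => /eqP; rewrite -addr_eq0 -mulr2n.
move=> /eqP/mpolyP p0; apply/mpolyP => m; have /eqP := p0 m.
by rewrite mcoeffMn mcoeff0 mulrn_eq0 => /eqP.
Qed.

(** If [l] is injective on each block, it orders each pair inside a block in exactly one way. The
    count is thus independent of [l], so the order of the indices can be traded for that of the
    exponents. *)
Lemma double_sum_lt_block col (l : 'I_N -> nat) :
    (forall i j, col i = col j -> l i = l j -> i = j) ->
  ((\sum_i \sum_j ((l i < l j) && (col i == col j))).*2 =
   \sum_i \sum_j ((i != j) && (col i == col j)))%N.
Proof.
move=> l_inj; rewrite -addnn {2}exchange_big -big_split /=.
apply: eq_bigr => i _; rewrite -big_split; apply: eq_bigr => j _ /=.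
rewrite [col j == _]eq_sym; case: (col i =P col j) => [cij|]; last by rewrite !andbF.
rewrite !andbT; case: ltngtP => [||/(l_inj _ _ cij) ->]; last by rewrite eqxx.
- by case: eqP => // ->; rewrite ltnn.
- by case: eqP => // ->; rewrite ltnn.
Qed.

(** The members of the block of [j] with exponent below [m j] have distinct exponents, so there are
    at most [m j] of them; sum over [j]. *)
Lemma block_exponents_ge col (m : 'X_{1..N}) :
    (forall i j, col i = col j -> m i = m j -> i = j) ->
  (\sum_(i < N) \sum_(j < N) ((i < j) && (col i == col j)) <= mdeg m)%N.
Proof.
move=> m_inj; rewrite -leq_double double_sum_lt_block => [|i j _ /val_inj //].
rewrite -(double_sum_lt_block m_inj) leq_double exchange_big mdegE /=.
apply: leq_sum => j _; rewrite -big_mkcond sum1_card /= cardE -(size_map m).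
rewrite -[leqRHS](size_iota 0); apply: uniq_leq_size.
  rewrite map_inj_in_uniq ?enum_uniq // => i k.
  rewrite !mem_enum => /andP[_ /eqP ij] /andP[_ /eqP kj].
  by apply: m_inj; rewrite ij kj.
by move=> _ /mapP[i + ->]; rewrite mem_enum mem_iota => /andP[].
Qed.

Lemma card_pairs (P : rel 'I_N) :
  #|[pred ij : 'I_N * 'I_N | P ij.1 ij.2]| = (\sum_i \sum_j P i j)%N.
Proof.
by rewrite -sum1_card big_mkcond pair_bigA.
Qed.

Lemma asym_blocks_eq0 col (U G : {mpoly int[N]}) d :
    {homo col : i j / (i <= j)%N} ->
    (forall i j, col i = col j -> msym (tperm i j) U = U) ->
    G \is d.-homog ->
    (d < \sum_(i < N) \sum_(j < N) ((i.+1 == j) && (col i == col j)))%N ->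
  asym (diff_prod _ (fun i j => (i.+1 < j)%N) *
        (diff_prod _ (fun i j => (i.+1 == j) && (col i != col j)) * U * G)) = 0.
Proof.
move=> col_homo Usym Gh d_lt.
(* [Q] collects the nonadjacent pairs inside a block and [B] all pairs across blocks. Blocks being
   intervals, these relations exhaust the factors other than [U] and [G]. *)
pose Q (i j : 'I_N) := (i.+1 < j)%N && (col i == col j).
pose B (i j : 'I_N) := (col i < col j)%N.
have -> : diff_prod _ (fun i j => (i.+1 < j)%N) *
    (diff_prod _ (fun i j => (i.+1 == j) && (col i != col j)) * U * G) =
    (diff_prod _ Q * G) * (diff_prod _ B * U).
  have lt_col i j : (col i < col j)%N = (i < j)%N && (col i != col j).
    rewrite ltn_neqAle; case: eqVneq => [|cij] /=; first by rewrite andbF.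
    case: (ltnP i j) => [/ltnW/col_homo //|/col_homo cji].
    by rewrite leqNgt ltn_neqAle eq_sym cij cji.
  have -> : diff_prod _ (fun i j : 'I_N => (i.+1 < j)%N) = diff_prod _ Q *
      diff_prod _ (fun i j : 'I_N => (i.+1 < j)%N && (col i != col j)) :> {mpoly int[N]}.
    apply/esym/diff_prodM => i j; rewrite /Q;
      by case: (_ == _); rewrite ?andbF ?andbT ?orbF.
  have -> : diff_prod _ B =
      diff_prod _ (fun i j : 'I_N => (i.+1 < j)%N && (col i != col j)) *
      diff_prod _ (fun i j => (i.+1 == j) && (col i != col j)) :> {mpoly int[N]}.
    apply/esym/diff_prodM => i j.
      by case: ltngtP; rewrite ?andbF.
    by rewrite /B lt_col -andb_orl orbC -leq_eqVlt.
  by rewrite -!mulrA; congr (_ * _); rewrite !mulrA mulrC !mulrA.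
have QGh : (diff_prod _ Q * G : {mpoly int[N]}) \is
    (#|[pred ij : 'I_N * 'I_N | Q ij.1 ij.2]| + d).-homog.
  by apply: dhomogM => //; apply: dhomog_diff_prod.
rewrite [diff_prod _ Q * G]mpolyE mulr_suml raddf_sum /= big_seq big1 // => m mQG.
rewrite -scalerAl asymZ.
(* Swapping two indices of one block with equal exponents in [m] fixes ['X_[m]], the product over
   [B] and [U]. *)
suff [i [j [ij cij mij]]] : exists i j, [/\ i != j, col i = col j & m i = m j].
  rewrite (@asym_tperm_eq0 _ i j) ?scaler0 // rmorphM rmorphM /= Usym //.
  congr (_ * (_ * _)).
    rewrite msymX; congr ('X_[_]); apply/mnmP => k; rewrite mnmE tpermV.
    by case: tpermP => // ->.
  apply: msym_diff_prod => k l; rewrite /B.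
  have colt x : col (tperm i j x) = col x by case: tpermP => // ->.
  by rewrite !colt.
have mdegm := dhomog_mf QGh mQG.
case: (boolP [exists i, exists j, [&& i != j, col i == col j & m i == m j]]).
  by move=> /existsP[i /existsP[j /and3P[ij /eqP cij /eqP mij]]]; exists i, j.
move=> /existsPn m_inj; move: d_lt; rewrite ltnNge => /negP[].
(* With distinct exponents in every block, [mdeg m] would be at least the number of pairs inside
   blocks: those of [Q] plus the adjacent ones, which outnumber [d]. *)
rewrite -(leq_add2l #|[pred ij : 'I_N * 'I_N | Q ij.1 ij.2]|) -mdegm.
apply: leq_trans (@block_exponents_ge col m _) => [|i j cij mij].
  rewrite card_pairs -big_split leq_sum // => i _.
  rewrite -big_split leq_sum // => j _; rewrite /Q.
  by case: ltngtP; case: (_ == _).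
apply/eqP/negPn; apply: contra (m_inj i) => ij; apply/existsP; exists j.
by rewrite ij cij mij !eqxx.
Qed.
End Vanishing.

(** * The operator [Esym], adjacent differences and partial sums *)

Section Operator.
Variables (R : comNzRingType) (n : nat).
Implicit Types p q : {mpoly R[n.+1]}.

Definition lord (i : 'I_n) : 'I_n.+1 := widen_ord (leqnSn n) i.
Definition rord (i : 'I_n) : 'I_n.+1 := lift ord0 i.

Definition adiff (i : 'I_n) : {mpoly R[n.+1]} := 'X_(lord i) - 'X_(rord i).

(* Shifted indexing: y_i is [psum i.+1], so that [psum 0 = 0]. *)
Definition psum (k : nat) : {mpoly R[n.+1]} := \sum_(j < n.+1 | (j < k)%N) 'X_j.

Definition sep_prod : {mpoly R[n.+1]} :=
  diff_prod R (fun i j => (i.+1 < j)%N).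

(* Up to the factor [vand], this is the map Phi. *)
Definition Esym p := asym (sep_prod * p).

Lemma Esym_is_additive : additive Esym.
Proof. by move=> p q; rewrite /Esym mulrBr raddfB. Qed.

HB.instance Definition _ :=
  GRing.isAdditive.Build {mpoly R[n.+1]} {mpoly R[n.+1]} Esym Esym_is_additive.

Lemma EsymZ c p : Esym (c *: p) = c *: Esym p.
Proof. by rewrite /Esym -scalerAr asymZ. Qed.

Lemma big_adjacent (T : Type) (idx : T) (op : Monoid.com_law idx)
    (P : rel 'I_n.+1) (f : 'I_n.+1 * 'I_n.+1 -> T) :
  \big[op/idx]_(ij : 'I_n.+1 * 'I_n.+1 | (ij.1.+1 == ij.2) && P ij.1 ij.2) f ij =
  \big[op/idx]_(i < n | P (lord i) (rord i)) f (lord i, rord i).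
Proof.
rewrite (reindex_omap (fun i : 'I_n => (lord i, rord i))
  (fun ij : 'I_n.+1 * 'I_n.+1 => insub (val ij.1))) => [|[i j] /andP[/= /eqP ij _]].
  apply: eq_bigl => i /=. rewrite valK.
  by rewrite /bump /= add1n !eqxx andbT.
have lt_in : (i < n)%N by rewrite -ltnS ij.
by rewrite insubT /=; congr (Some (_, _)); apply: val_inj.
Qed.

Lemma diff_prod_adjacent (P : rel 'I_n.+1) :
  diff_prod R (fun i j => (i.+1 == j) && P i j) =
  \prod_(i < n | P (lord i) (rord i)) adiff i.
Proof. by rewrite /diff_prod big_adjacent. Qed.

Lemma sep_prod_adiff : sep_prod * \prod_(i < n) adiff i = vand R n.+1.
Proof.
have <- := diff_prod_adjacent (fun _ _ => true).
apply: diff_prodM => i j; first by case: ltngtP.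
by rewrite andbT orbC -leq_eqVlt.
Qed.

Lemma adiffE (i : 'I_n) : adiff i = psum i.+1 *+ 2 - psum i - psum i.+2.
Proof.
have psumS (k : 'I_n.+1) : psum k.+1 = psum k + 'X_k.
  rewrite /psum (bigD1 k) //= addrC; congr (_ + _).
  by apply: eq_bigl => j; rewrite ltnS ltn_neqAle andbC.
have -> : i.+2 = (rord i).+1 by [].
rewrite psumS /= (psumS (lord i)) /= /adiff; ring.
Qed.

Lemma psum0 : psum 0 = 0.
Proof. exact: big_pred0_eq. Qed.

Lemma dhomog_psum k : psum k \is 1.-homog.
Proof. by apply: rpred_sum => i _; apply: dhomog_var. Qed.

Lemma msym_psum k (i j : 'I_n.+1) :
  (i < k)%N = (j < k)%N -> msym (tperm i j) (psum k) = psum k.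
Proof.
move=> ij; rewrite /psum raddf_sum /= [RHS](reindex_inj (@perm_inj _ (tperm i j))) /=.
apply: eq_big => [l|l _]; last by rewrite msymXU.
by case: tpermP => [->|->|].
Qed.

End Operator.

(** * Linear relations satisfied by [Esym] *)

Section Relations.
Variable n : nat.
Implicit Types (G : {mpoly int[n.+1]}) (col : nat -> nat).
Local Notation Y := (@psum int n).
Local Notation E := (@Esym int n).

(** Blocks are the level sets of [col], hence intervals. The factors of D at their boundaries are
    supplied, [Y k] is symmetric in each block because none straddles [k], and [d] is below the
    number of adjacent pairs inside blocks. *)
Lemma Esym_blocks_eq0 col k G d :
    {homo col : i j / (i <= j)%N} ->
    (forall i j : 'I_n.+1, col i = col j -> (i < k)%N = (j < k)%N) ->
    G \is d.-homog -> (d < #|[pred i : 'I_n | col i == col i.+1]|)%N ->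
  E ((\prod_(i < n | col i != col i.+1) adiff int i) * Y k * G) = 0.
Proof.
move=> col_homo colk Gh d_lt.
rewrite /Esym -(diff_prod_adjacent _ (fun i j => col i != col j)).
apply: (@asym_blocks_eq0 _ col _ _ d) => // [i j le_ij|i j /colk|].
- exact: col_homo.
- exact: msym_psum.
rewrite -(card_pairs (fun i j : 'I_n.+1 => (i.+1 == j) && (col i == col j))).
rewrite -sum1_card (eq_bigl (fun ij : 'I_n.+1 * 'I_n.+1 =>
  (ij.1.+1 == ij.2) && (col ij.1 == col ij.2))) //.
rewrite (big_adjacent _ (fun i j : 'I_n.+1 => col i == col j)) sum1_card.
exact: d_lt.
Qed.

Lemma card_ord_lt m : (m <= n)%N -> #|[pred i : 'I_n | (i < m)%N]| = m.
Proof.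
move=> le_mn; rewrite -sum1_card (big_ord_narrow le_mn).
by rewrite sum1_card card_ord.
Qed.

(** A single block, with all [n] adjacent pairs inside. *)
Lemma Esym_total_eq0 G d : G \is d.-homog -> (d < n)%N -> E (Y n.+1 * G) = 0.
Proof.
move=> Gh d_lt; have := @Esym_blocks_eq0 (fun=> 0%N) n.+1 G d.
rewrite big_pred0 ?mul1r => [|i]; last by rewrite eqxx.
apply=> //; last by rewrite eq_cardT ?size_enum_ord.
by move=> i j _; rewrite !ltn_ord.
Qed.

(** Two blocks, cut just after [i], leave [n.-1] adjacent pairs inside. *)
Lemma Esym_split_eq0 (i : 'I_n) G d :
  G \is d.-homog -> (d < n.-1)%N -> E (adiff int i * Y i.+1 * G) = 0.
Proof.
move=> Gh d_lt; have := @Esym_blocks_eq0 (fun j => (i < j)%N) i.+1 G d.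
rewrite (big_pred1 i) => [|j]; last first.
  by rewrite /= -val_eqE /=; lia.
apply=> //.
- by move=> j k; lia.
- by move=> j k; lia.
apply: leq_trans d_lt _; rewrite -[in leqLHS](card_ord n) -(cardC1 i).
by apply/subset_leq_card/subsetP => j; rewrite !inE -val_eqE /=; do ?case: ifP; lia.
Qed.

Section Tail.
Variable k : nat.
Hypothesis lt_kn : (k < n)%N.

Definition tail : {mpoly int[n.+1]} := \prod_(i < n | (k < i)%N) adiff int i.

(** One block of the indices up to [k.+1], then singletons: [k.+1] adjacent pairs lie inside. *)
Lemma Esym_tail_eq0 G d :
  G \is d.-homog -> (d <= k)%N -> E (tail * Y k.+2 * G) = 0.
Proof.
move=> Gh d_lt; pose col i := if (i <= k.+1)%N then 0%N else i.
have := @Esym_blocks_eq0 col k.+2 G d.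
rewrite (eq_bigl (fun i : 'I_n => (k < i)%N)) => [|i]; last by rewrite /col; do ?case: ifP; lia.
apply=> //; rewrite /col; [move=> ? ?; do ?case: ifP; lia|move=> ? ?; do ?case: ifP; lia|].
rewrite (@leq_trans k.+1) // -[leqLHS](card_ord_lt lt_kn).
by apply/subset_leq_card/subsetP => i; rewrite !inE; do ?case: ifP; lia.
Qed.

(** The block of indices up to [k.+1] is cut further after [i], which leaves [k] adjacent pairs
    inside. *)
Lemma Esym_split_tail_eq0 (i : 'I_n) G d : (i <= k)%N ->
  G \is d.-homog -> (d < k)%N -> E (adiff int i * tail * Y i.+1 * G) = 0.
Proof.
move=> le_ik Gh d_lt.
pose col j := if (j <= i)%N then 0%N else if (j <= k.+1)%N then 1%N else j.
have := @Esym_blocks_eq0 col i.+1 G d.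
rewrite (bigD1 i) /=; last by rewrite /col; do ?case: ifP; lia.
rewrite (eq_bigl (fun i : 'I_n => (k < i)%N)) => [|j]; last first.
  by rewrite /col -val_eqE /=; do ?case: ifP; lia.
apply=> //; rewrite /col; [move=> ? ?; do ?case: ifP; lia|move=> ? ?; do ?case: ifP; lia|].
have := card_ord_lt lt_kn; rewrite (cardD1 i) inE ltnS le_ik => -[cardk].
apply: leq_trans d_lt _; rewrite -[leqLHS]cardk.
by apply/subset_leq_card/subsetP => j; rewrite !inE -val_eqE /=; do ?case: ifP; lia.
Qed.
End Tail.

End Relations.

Lemma mpoly_mulrnI N (p q : {mpoly int[N]}) k : p *+ k.+1 = q *+ k.+1 -> p = q.
Proof.
move=> pq; apply/mpolyP => m; apply: (@pmulrnI _ k.+1) => //=.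
by rewrite -!mcoeffMn pq.
Qed.

(** * The value on the product of the first n partial sums *)

Section Standard.
Variable n : nat.
Local Notation Y := (@psum int n).
Local Notation E := (@Esym int n).

(** Interpolates between D at [k = 0] and the product of the first [n] partial sums at [k = n]. *)
Definition stair (k : nat) : {mpoly int[n.+1]} :=
  (\prod_(i < k) Y i.+1) * \prod_(i < n | (k <= i)%N) adiff int i.

Lemma Esym_second_diff a b c : E (a *+ 2 - b - c) = E a *+ 2 - E b - E c.
Proof. by rewrite (raddfB E) (raddfB E) (raddfMn E). Qed.

(* [e i] below vanishes at i = 0 and i = k + 2 and is affine for i <= k + 1,
   so that e i = i e_1 there. *)
Lemma Esym_stairS k : (k < n)%N ->
  E (stair k.+1) *+ k.+2 = E (stair k) *+ k.+1.
Proof.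
move=> lt_kn; pose PY := \prod_(i < k) Y i.+1.
pose e i := E (PY * Y i * tail n k).
have PYh : PY \is k.-homog.
  have := @dhomog_big_prod int n.+1 _ (index_enum 'I_k) xpredT
    (fun i => Y i.+1) (fun=> 1%N) (fun i _ => dhomog_psum int n i.+1).
  by rewrite sum1_card card_ord.
have e0 : e 0%N = 0 by rewrite /e psum0 mulr0 mul0r raddf0.
have e_last : e k.+2 = 0.
  by rewrite -(Esym_tail_eq0 lt_kn PYh (leqnn k)) /e; congr (E _); ring.
have e_harm i : (i < k)%N -> e i.+2 = e i.+1 *+ 2 - e i.
  move=> lt_ik; pose o := Ordinal lt_ik.
  pose G := \prod_(j < k | j != o) Y j.+1.
  have PYE : PY = Y i.+1 * G by rewrite /PY (bigD1 o).
  have Gh : G \is k.-1.-homog.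
    have := @dhomog_big_prod int n.+1 _ (index_enum 'I_k) (predC1 o)
      (fun i => Y i.+1) (fun=> 1%N) (fun i _ => dhomog_psum int n i.+1).
    by rewrite sum1_card cardC1 card_ord.
  have lt_in : (i < n)%N by lia.
  have := @Esym_split_tail_eq0 _ _ lt_kn (Ordinal lt_in) G _ (ltnW lt_ik) Gh.
  rewrite adiffE /= => /(_ ltac:(lia)) E0; apply/eqP.
  rewrite eq_sym -subr_eq0 -E0 /e -Esym_second_diff PYE; apply/eqP.
  by congr (E _); ring.
have e_lin i : (i <= k)%N -> e i = e 1%N *+ i /\ e i.+1 = e 1%N *+ i.+1.
  elim: i => [|i IHi] le_ik; first by rewrite e0.
  have [ei ei1] := IHi (ltnW le_ik); split=> //.
  rewrite e_harm // ei ei1; ring.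
have -> : E (stair k.+1) = e k.+1 by rewrite /stair big_ord_recr.
have [ek ek1] := e_lin k (leqnn k).
(* Expanding the factor [adiff k] as a second difference gives [E (stair k)] the value
   [2 e_(k+1) - e_k - e_(k+2) = (k + 2) e_1], against [(k + 1) e_1] for [stair k.+1]. *)
have -> : stair k = PY * Y k.+1 * tail n k *+ 2 - PY * Y k * tail n k
    - PY * Y k.+2 * tail n k.
  rewrite /stair (bigD1 (Ordinal lt_kn)) //= adiffE /=.
  rewrite (eq_bigl (fun i : 'I_n => (k < i)%N)) => [|i].
    rewrite -/(tail n k) -/PY; ring.
  by rewrite -val_eqE /= ltn_neqAle andbC eq_sym.
rewrite Esym_second_diff -/(e k.+1) -/(e k) -/(e k.+2) e_last ek ek1; ring.
Qed.

(** [E (stair k) *+ k.+1] is independent of [k]; compare [k = 0] with [k = n] and cancel [n.+1]. *)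
Lemma Esym_standard : E (\prod_(i < n) Y i.+1) = vand int n.+1 *+ n`!.
Proof.
have E_stair k : (k <= n)%N -> E (stair k) *+ k.+1 = vand int n.+1 *+ n.+1`!.
  elim: k => [_|k IHk lt_kn]; last by rewrite Esym_stairS // IHk // ltnW.
  by rewrite mulr1n /stair big_ord0 mul1r /Esym sep_prod_adiff asym_vand.
have := E_stair n (leqnn n); rewrite /stair [X in _ * X]big_pred0 ?mulr1.
  by rewrite factS mulnC mulrnA => /mpoly_mulrnI.
by move=> i; rewrite leqNgt ltn_ord.
Qed.
End Standard.

(** * Successor, predecessor and distance on the cycle *)

Section CyclicSuccessor.
Variable n : nat.
Implicit Types i z : 'I_n.+1.

Lemma val_ordS i : ordS i = (if i == n :> nat then 0 else i.+1)%N :> nat.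
Proof.
rewrite /=; case: eqP => [->|ne_in]; first exact: modnn.
by rewrite modn_small // ltnS ltn_neqAle -ltnS ltn_ord andbT; apply/eqP.
Qed.

Lemma val_ord_pred i : ord_pred i = (if i == 0 :> nat then n else i.-1)%N :> nat.
Proof.
rewrite /= addnS /=; case: eqP => [->|/eqP]; first by rewrite modn_small.
case: i => -[//|i] /= lt_i _; rewrite addSnnS modnDr modn_small //; exact: ltnW.
Qed.

Lemma ordSD i (k : 'I_n.+1) : ordS i + k = ordS (i + k).
Proof. by apply: val_inj; rewrite /= modnDml -[(_ %% _).+1]addn1 modnDml addSn addn1. Qed.

Lemma ord_predD i (k : 'I_n.+1) : ord_pred i + k = ord_pred (i + k).
Proof. by apply: (can_inj (@ordSK _)); rewrite -ordSD !ord_predK. Qed.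

(* The number of upward steps from i to z on the cycle of length n + 1. *)
Definition cdist z i := (if i <= z then z - i else z + n.+1 - i)%N.

Lemma cdist_ordS z i : i != z -> (cdist z (ordS i) < cdist z i)%N.
Proof.
rewrite /cdist val_ordS -val_eqE /=; have := ltn_ord i; have := ltn_ord z.
by do ?case: ifP; lia.
Qed.
End CyclicSuccessor.

(** * Maximum principle for n chips on n + 1 sites *)

Section MaximumPrinciple.
Variable n : nat.
Local Notation conf := {ffun 'I_n -> 'I_n.+1}.
Implicit Types (phi : conf) (f : conf -> int).

Definition upd phi j x : conf := [ffun l => if l == j then x else phi l].

(** Only configurations with a shared site are constrained; the injective ones act as the
    boundary. *)
Definition harmonic f := forall phi j l, j != l -> phi j = phi l ->
  f phi *+ 2 = f (upd phi j (ordS (phi j))) + f (upd phi j (ord_pred (phi j))).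

(* While two chips share a site, one of them is moved upward; f stays maximal
   by harmonicity.  Each move brings the chip closer to a chosen empty site z,
   and filling z increases the number of occupied sites, so an injective
   configuration is reached. *)
Lemma harmonic_max f c phi :
    harmonic f -> (forall psi : conf, injective psi -> f psi = c) ->
    (forall psi, f psi <= f phi) ->
  f phi = c.
Proof.
move=> f_harm f_inj.
pose im (psi : conf) := [set psi j | j : 'I_n].
have missing psi : exists z, z \notin im psi.
  apply/existsP; rewrite -negb_forall; apply/negP => /forallP im_all.
  have := leq_imset_card psi 'I_n; rewrite -/(im psi) card_ord.
  have -> : im psi = setT by apply/setP => z; rewrite im_all inE.
  by rewrite cardsT card_ord ltnn.
have [e le_e] := ubnP (n.+1 - #|im phi|).
elim: e => // e IHe in phi le_e *.
have [z z_im] := missing phi.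
have [d] := ubnP (\sum_j cdist z (phi j)).
elim: d => // d IHd in phi le_e z_im *; rewrite ltnS => le_d f_max.
have [/injectiveP/f_inj // | /injectivePn[j [l ne_jl eq_jl]]] :=
  boolP (injectiveb phi).
pose psi := upd phi j (ordS (phi j)).
have psi_j : psi j = ordS (phi j) by rewrite ffunE eqxx.
have psi_ne x : x != j -> psi x = phi x by rewrite ffunE => /negPf->.
(* The site left by chip [j] remains occupied by chip [l]. *)
have sub_im : im phi \subset im psi.
  apply/subsetP => _ /imsetP[x _ ->]; have [->|ne_xj] := eqVneq x j.
    by rewrite eq_jl -(psi_ne l) 1?eq_sym // imset_f.
  by rewrite -psi_ne // imset_f.
have f_psi : f psi = f phi.
  have := f_harm phi j l ne_jl eq_jl; rewrite -/psi.
  have := f_max psi; have := f_max (upd phi j (ord_pred (phi j))); lia.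
rewrite -f_psi; have [psi_z|psi_z] := eqVneq (psi j) z.
  apply: IHe; last by rewrite f_psi.
  have : (#|im phi| < #|im psi|)%N.
    apply: proper_card; rewrite properE sub_im; apply/subsetPn.
    by exists z => //; rewrite -psi_z imset_f.
  by have := max_card (im psi); rewrite card_ord; lia.
apply: IHd; last by rewrite f_psi.
- by apply: leq_ltn_trans le_e; rewrite leq_sub2l // subset_leq_card.
- apply/imsetP => -[x _ z_x]; have [xj|/psi_ne xj] := eqVneq x j.
    by rewrite z_x xj eqxx in psi_z.
  by rewrite z_x xj imset_f in z_im.
apply: leq_trans le_d; rewrite (bigD1 j) // [ltnRHS](bigD1 j) //= psi_j.
rewrite (eq_bigr (fun x => cdist z (phi x))) => [|x /psi_ne-> //].
rewrite ltn_add2r cdist_ordS //; apply: contra z_im => /eqP <-.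
exact: imset_f.
Qed.

(** Apply [harmonic_max] at a maximizer of [f] and at one of [- f]; both exist since configurations
    are finite in number. *)
Lemma harmonic_const f c phi :
    harmonic f -> (forall psi : conf, injective psi -> f psi = c) ->
  f phi = c.
Proof.
move=> f_harm f_inj.
have le_c g b psi : harmonic g -> (forall psi : conf, injective psi -> g psi = b) ->
    g psi <= b.
  move=> g_harm g_inj.
  pose top := [arg max_(x > psi) g x]%O.
  have top_max x : g x <= g top by rewrite /top; case: arg_maxP => //= t _ ->.
  by rewrite -(harmonic_max g_harm g_inj top_max) top_max.
apply/eqP; rewrite eq_le le_c //= -lerN2.
apply: (le_c (fun x => - f x)) => [x j l ne_jl eq_jl|x /f_inj -> //].
by rewrite mulNrn (f_harm x j l) // opprD.
Qed.
End MaximumPrinciple.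

(** * Cyclic sums of products of partial sums *)

Section CyclicSum.
Local Opaque Esym psum.
Variable n : nat.
Local Notation Y := (@psum int n).
Local Notation E := (@Esym int n).
Implicit Types psi : 'I_n -> 'I_n.+1.

(** The two factors at site [c] form a square, so the claim concerns a second difference around [c]
    times [Y c.+1 * G]. The end sites 0 and [n] need [Esym_total_eq0], as the cycle closes up
    there. *)
Lemma Esym_harmonic psi j l : j != l -> psi j = psi l ->
  E (\prod_i Y (psi i).+1) *+ 2 =
  E (\prod_i Y (if i == j then ordS (psi j) else psi i).+1) +
  E (\prod_i Y (if i == j then ord_pred (psi j) else psi i).+1).
Proof.
move=> ne_jl eq_jl.
pose G := \prod_(i < n | (i != j) && (i != l)) Y (psi i).+1.
have Gh : G \is n.-2.-homog.
  have := @dhomog_big_prod int n.+1 _ (index_enum 'I_n)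
    (fun i => (i != j) && (i != l)) (fun i => Y (psi i).+1)
    (fun=> 1%N) (fun i _ => dhomog_psum int n (psi i).+1).
  suff -> : (\sum_(i < n | (i != j) && (i != l)) 1)%N = n.-2 by [].
  have := cardC1 j; rewrite (cardD1 l) inE eq_sym ne_jl card_ord add1n => card_jl.
  rewrite sum1_card; rewrite -card_jl /=.
  by apply: eq_card => i; rewrite !inE andbC.
have split_prod (x : 'I_n.+1) :
    \prod_i Y (if i == j then x else psi i).+1 = Y x.+1 * (Y (psi j).+1 * G).
  have ne_lj : l != j by rewrite eq_sym.
  rewrite (bigD1 j) //= eqxx (bigD1 l ne_lj) /= (negPf ne_lj) eq_jl.
  by congr (_ * (_ * _)); apply: eq_bigr => i /andP[/negPf-> _].
have -> : \prod_i Y (psi i).+1 = \prod_i Y (if i == j then psi j else psi i).+1.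
  by apply: eq_bigr => i _; case: eqP => // ->.
rewrite !split_prod; set c := psi j.
have lt2n : (1 < n)%N.
  have := ltn_ord j; have := ltn_ord l.
  by move: ne_jl; rewrite -val_eqE /=; lia.
apply/eqP; rewrite -subr_eq0 opprD addrA -Esym_second_diff; apply/eqP.
have YGh x : Y x * G \is n.-1.-homog.
  by have := dhomogM (dhomog_psum int n x) Gh; rewrite add1n prednK //; lia.
have total0 x : E (Y n.+1 * (Y x * G)) = 0.
  by apply: Esym_total_eq0 (YGh x) _; lia.
have [c_n|c_n] := eqVneq (c : nat) n.
  rewrite c_n; set p := (X in E X); pose u x := Y n.+1 * (Y x * G).
  have -> : p = u n.+1 *+ 2 - u (ordS c).+1 - u (ord_pred c).+1.
    rewrite /p /u; ring.
  by rewrite Esym_second_diff !total0 !subr0 mul0rn.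
have lt_cn : (c < n)%N by have := ltn_ord c; lia.
have := @Esym_split_eq0 n (Ordinal lt_cn) G _ Gh ltac:(lia).
rewrite adiffE val_ordS val_ord_pred /= (negPf c_n).
case: eqP => [->|c_0] => [E0|<-]; last first.
  by rewrite prednK; [congr (E _); ring|lia].
(* The predecessor of site 0 is site [n]: the claim has [Y n.+1] where [E0] has [Y 0 = 0], and the
   extra term vanishes. *)
rewrite psum0 in E0.
set p := (X in E X); pose q := (Y 1 *+ 2 - 0 - Y 2) * Y 1 * G.
have -> : p = q - Y n.+1 * (Y 1 * G) by rewrite /p /q; ring.
by rewrite (raddfB E) /= total0 E0 subrr.
Qed.

(** Site [n] carries the sum of all variables, which annihilates the product. If it is empty, the
    chips fill the other [n] sites exactly. *)
Lemma Esym_prod_inj psi : injective psi ->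
  E (\prod_i Y (psi i).+1) =
  if ord_max \in codom psi then 0 else E (\prod_(i < n) Y i.+1).
Proof.
move=> psi_inj; case: ifPn => [/codomP[j psi_j]|max_im].
  rewrite (bigD1 j) // -psi_j /=; apply: (@Esym_total_eq0 _ _ n.-1).
    have := @dhomog_big_prod int n.+1 _ (index_enum 'I_n) (predC1 j)
      (fun i => Y (psi i).+1) (fun=> 1%N) (fun i _ => dhomog_psum int n (psi i).+1).
    by rewrite sum1_card cardC1 card_ord.
  by have := ltn_ord j; lia.
have -> : \prod_i Y (psi i).+1 = \prod_(x in [set psi i | i : 'I_n]) Y x.+1.
  by rewrite big_imset //= => x y _ _; apply: psi_inj.
have -> : [set psi i | i : 'I_n] = [set~ ord_max].
  apply/eqP; rewrite eqEcard cardsC1 card_imset // !card_ord leqnn andbT.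
  apply/subsetP => _ /imsetP[i _ ->]; rewrite !inE.
  by apply: contra max_im => /eqP <-; apply: codom_f.
rewrite (eq_bigl (predC1 ord_max)) => [|x]; last by rewrite !inE.
congr (E _); have -> : \prod_(i < n) Y i.+1 = \prod_(i < n) Y (lord i).+1 by [].
rewrite big_mkcond big_ord_recr /= eqxx mulr1.
by apply: eq_bigr => i _; rewrite -val_eqE /= ltn_eqF.
Qed.

(** A monomial of degree [n] in the partial sums is encoded by the indices of its factors, that is,
    by a chip configuration. *)
Definition cyclic_sum psi : {mpoly int[n.+1]} :=
  \sum_(k < n.+1) E (\prod_i Y (psi i + k)%R.+1).

Lemma eq_Esym_prod psi chi : psi =1 chi ->
  E (\prod_i Y (psi i).+1) = E (\prod_i Y (chi i).+1).
Proof.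
by move=> eq_psi; apply: (congr1 E); apply: eq_bigr => i _; rewrite eq_psi.
Qed.

Lemma eq_cyclic_sum psi chi : psi =1 chi -> cyclic_sum psi = cyclic_sum chi.
Proof.
move=> eq_psi; apply: eq_bigr => k _.
by apply: eq_Esym_prod => i; rewrite eq_psi.
Qed.

Lemma cyclic_sum_harmonic psi j l : j != l -> psi j = psi l ->
  cyclic_sum psi *+ 2 =
  cyclic_sum (fun i => if i == j then ordS (psi j) else psi i) +
  cyclic_sum (fun i => if i == j then ord_pred (psi j) else psi i).
Proof.
move=> ne_jl eq_jl; rewrite /cyclic_sum -sumrMnl -big_split.
apply: eq_bigr => k _.
apply: etrans (@Esym_harmonic (fun i => psi i + k) j l ne_jl _) _.
  by rewrite eq_jl.
apply: (congr2 +%R); apply: eq_Esym_prod => i /=.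
  by case: (i == j); rewrite ?ordSD.
by case: (i == j); rewrite ?ord_predD.
Qed.

(** Exactly one shift moves the empty site [z] to [ord_max]; all other shifts contribute 0. *)
Lemma cyclic_sum_inj psi : injective psi ->
  cyclic_sum psi = E (\prod_(i < n) Y i.+1).
Proof.
move=> psi_inj.
have im_card : #|~: [set psi i | i : 'I_n]| = 1%N.
  have := cardsC [set psi i | i : 'I_n].
  by rewrite card_imset // !card_ord; lia.
have [z zE] := cards1P (introT eqP im_card).
have max_im (k : 'I_n.+1) :
    (ord_max \in codom (fun i => psi i + k)) = (k != ord_max - z).
  have -> : (k == ord_max - z) = (ord_max - k \in ~: [set psi i | i : 'I_n]).
    by rewrite zE inE eq_sym subr_eq addrC -subr_eq eq_sym.
  rewrite inE negbK; apply/codomP/imsetP => [[i ->]|[i _ /eqP]].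
    by exists i => //; rewrite addrK.
  by rewrite subr_eq => /eqP; exists i.
have shift_inj k : injective (fun i => psi i + k).
  by move=> i l /addIr; apply: psi_inj.
rewrite /cyclic_sum (bigD1 (ord_max - z)) // -[RHS]addr0.
apply: (congr2 +%R); first by rewrite (Esym_prod_inj (shift_inj _)) max_im eqxx.
apply: big1 => k /= ne_k.
by rewrite (Esym_prod_inj (shift_inj _)) max_im ne_k.
Qed.

Local Opaque cyclic_sum.

Lemma cyclic_sumE psi : cyclic_sum psi = vand int n.+1 *+ n`!.
Proof.
rewrite (@eq_cyclic_sum psi [ffun i => psi i]) => [|i]; last by rewrite ffunE.
(* The maximum principle needs ordered values, so it is applied to each coefficient. *)
apply/mpolyP => m; pose f (phi : {ffun 'I_n -> 'I_n.+1}) := (cyclic_sum phi)@_m.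
apply: (@harmonic_const n f) => [phi j l ne_jl eq_jl|phi /cyclic_sum_inj phiE].
  have updE x : f (upd phi j x) =
      (cyclic_sum (fun i => if i == j then x else phi i))@_m.
    by apply: (congr1 (mcoeff m)); apply: eq_cyclic_sum => i; rewrite ffunE.
  rewrite !updE -mcoeffMn -mcoeffD; apply: (congr1 (mcoeff m)).
  exact: cyclic_sum_harmonic ne_jl eq_jl.
by rewrite /f phiE Esym_standard.
Qed.
End CyclicSum.

(** * Passage to the field and conclusion *)

Section Transfer.
Variables (F : fieldType) (n : nat).
Local Notation toF := (map_mpoly (intr : int -> F)).

Lemma map_msym N (s : 'S_N) (p : {mpoly int[N]}) : toF (msym s p) = msym s (toF p).
Proof.
by apply/mpolyP => m; rewrite mcoeff_map_mpoly !mcoeff_sym mcoeff_map_mpoly.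
Qed.

Lemma map_diff_prod N (P : rel 'I_N) : toF (diff_prod int P) = diff_prod F P.
Proof.
rewrite rmorph_prod /=; apply: eq_bigr => ij _.
by rewrite rmorphB /= !map_mpolyX.
Qed.

Lemma map_psum k : toF (psum int n k) = psum F n k.
Proof. by rewrite raddf_sum /=; apply: eq_bigr => i _; rewrite map_mpolyX. Qed.

Lemma map_Esym (p : {mpoly int[n.+1]}) : toF (Esym p) = Esym (toF p).
Proof.
rewrite raddf_sum /=; apply: eq_bigr => s _.
by rewrite rmorphM rmorphXn rmorphN1 /= map_msym rmorphM /= map_diff_prod.
Qed.

Lemma Esym_field_cyclic_sum (psi : 'I_n -> 'I_n.+1) :
  \sum_(k < n.+1) Esym (\prod_i psum F n (psi i + k)%R.+1) = vand F n.+1 *+ n`!.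
Proof.
rewrite -[vand F _]map_diff_prod -raddfMn -(cyclic_sumE psi) raddf_sum /=.
apply: eq_bigr => k _; rewrite map_Esym; congr Esym.
by rewrite rmorph_prod /=; apply: eq_bigr => i _; rewrite map_psum.
Qed.

Lemma vand_neq0 N : vand F N != 0.
Proof.
apply/prodf_neq0 => -[i j] /= lt_ij; apply/eqP => /mpolyP/(_ U_(i)%MM)/eqP.
rewrite mcoeffB !mcoeffXU eqxx mcoeff0 -val_eqE /= gtn_eqF // subr0.
by rewrite oner_eq0.
Qed.

(** With D the product of the [adiff], [vand] equals [(-1) ^+ s] times [msym s (sep_prod * D)]; thus
    expanding each fraction by [msym s sep_prod] brings all terms over [vand]. *)
Lemma Phi_Esym (f : {mpoly F[n.+1]}) : Phi f = (Esym f)%:F / (vand F n.+1)%:F.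
Proof.
have D0 : \prod_(i < n) adiff F i != 0.
  by have := vand_neq0 n.+1; rewrite -sep_prod_adiff mulf_eq0 negb_or => /andP[].
have -> : Phi f = Defs.Sym (f%:F / (\prod_(i < n) adiff F i)%:F) by [].
rewrite /Esym /asym raddf_sum mulr_suml /Defs.Sym; apply: eq_bigr => s _.
rewrite perm_fracE //; apply/eqP.
have neq0 p : p != 0 -> (msym s p)%:F != 0.
  by rewrite tofrac_eq0 -(inj_eq (@inj_msym _ _ s)) msym0.
rewrite eqr_div ?neq0 ?tofrac_eq0 ?vand_neq0 // -!tofracM tofrac_eq.
have -> : vand F n.+1 = (-1) ^+ s * msym s (vand F n.+1).
  by rewrite msym_vand signrMK.
rewrite -sep_prod_adiff !msymM; apply/eqP.
set W := msym s (sep_prod _ _). set D := msym s (\prod_(i < n) _). set p := msym s f.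
by rewrite mulrCA -!mulrA; congr (_ * _); rewrite mulrCA [p * _]mulrC.
Qed.

(** [m2s m] repeats each index [i] exactly [m i] times, turning exponents into a list of factors. *)
Lemma prod_mpow_seq (R : comNzRingType) N (g : 'I_N -> R) (m : 'X_{1..N}) :
  \prod_(i < N) g i ^+ m i = \prod_(i <- m2s m) g i.
Proof.
rewrite /m2s big_flatten big_map big_enum /=; apply: eq_bigr => i _.
by rewrite big_nseq iter_mulr_1.
Qed.

(** By linearity it suffices to treat monomials; each contributes the same multiple of [vand], so
    only the sum of the coefficients of [h] remains. *)
Lemma cyclic_shift_sum (h : {mpoly F[n.+1]}) : h \is n.-homog ->
  Esym (\sum_(k < n.+1) cyclic_shift h k) = (n`!%:R * h.@[fun=> 1]) *: vand F n.+1.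
Proof.
move=> h_homog.
pose g k (m : 'X_{1..n.+1}) := \prod_(i < n.+1) psum F n (i + k)%R.+1 ^+ m i.
have -> : \sum_(k < n.+1) cyclic_shift h k =
    \sum_(m <- msupp h) h@_m *: \sum_(k < n.+1) g k m.
  under [RHS]eq_bigr => m _ do rewrite scaler_sumr.
  rewrite [RHS]exchange_big; apply: eq_bigr => k _.
  rewrite /cyclic_shift comp_mpolyE; apply: eq_bigr => m _; congr (_ *: _).
  by apply: eq_bigr => i _; rewrite tnth_mktuple.
rewrite (raddf_sum (@Esym F n)) /= mevalE mulr_sumr scaler_suml big_seq [RHS]big_seq.
apply: eq_bigr => m m_h; rewrite EsymZ (raddf_sum (@Esym F n)) /=.
have size_m : size (m2s m) = n by rewrite size_m2s (dhomog_mf h_homog m_h).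
(* The default [ord0] is never reached, as [m2s m] has size [n]. *)
pose psi (j : 'I_n) : 'I_n.+1 := nth ord0 (m2s m) j.
have -> : \sum_(k < n.+1) Esym (g k m) = vand F n.+1 *+ n`!.
  rewrite -(Esym_field_cyclic_sum psi); apply: eq_bigr => k _; congr Esym.
  rewrite /g prod_mpow_seq (big_nth ord0) size_m big_mkord.
  exact: eq_bigr.
rewrite big1 ?mulr1 => [|i _]; last exact: expr1n.
by rewrite -scaler_nat scalerA mulrC.
Qed.
End Transfer.

Theorem theorem4 (F : fieldType) (n : nat) (n_gt0 : (0 < n)%N)
    (h : {mpoly F[n.+1]}) (h_homog : h \is n.-homog) :
  Phi (\sum_(k < n.+1) cyclic_shift h k) = ((n`!%:R * h.@[fun=> 1])%:MP)%:F.
Proof.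
rewrite Phi_Esym cyclic_shift_sum // -mul_mpolyC tofracM mulfK //.
by rewrite tofrac_eq0 vand_neq0.
Qed.
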